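(* For every support-preserving multiplicative map $\Phi\colon\mathcal{P}_{\mathbb{Q}}\to\mathcal{P}$ there exists a constant $\gamma>0$ such that $\Phi[p](x)=p(\gamma x)/p(\gamma)$ for all $p\in\mathcal{P}_{\mathbb{Q}}$.
   Context: $\mathcal{P}$ is the set of real polynomials $p(x)=\sum_{k=0}^d p_kx^k$ in one variable (of arbitrary degree) with $p_k\geq 0$ for all $k$ and $p(1)=1$. $\mathcal{P}_{\mathbb{Q}}\subset\mathcal{P}$ is the subset of those with all $p_k\in\mathbb{Q}_{\geq 0}$. A map $\Phi\colon\mathcal{P}_{\mathbb{Q}}\to\mathcal{P}$ is support-preserving if for every $p\in\mathcal{P}_{\mathbb{Q}}$ and every $k$, writing $p'=\Phi[p]$, one has $p'_k>0$ if and only if $p_k>0$. It is multiplicative if $\Phi[p\cdot q]=\Phi[p]\cdot\Phi[q]$ for all $p,q\in\mathcal{P}_{\mathbb{Q}}$. *)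

(* Defs.v *)
From mathcomp Require Import all_boot all_order all_algebra.
From mathcomp Require Import reals.
Set Implicit Arguments.
Unset Strict Implicit.
Unset Printing Implicit Defensive.
Import Order.TTheory GRing.Theory Num.Theory.
Local Open Scope ring_scope.

Definition in_P (R : realType) (p : {poly R}) : Prop :=
  (forall k : nat, 0 <= p`_k) /\ p.[1] = 1.

Definition in_PQ (R : realType) (p : {poly R}) : Prop :=
  in_P p /\ forall k : nat, exists q : rat, p`_k = ratr q.

(* A map from P_Q to P is represented by a function on all of {poly R}, whose
   values outside P_Q are arbitrary and never used. *)
Definition maps_PQ_to_P (R : realType) (Phi : {poly R} -> {poly R}) : Prop :=
  forall p : {poly R}, in_PQ p -> in_P (Phi p).

Definition support_preserving (R : realType) (Phi : {poly R} -> {poly R}) :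
    Prop :=
  forall p : {poly R}, in_PQ p -> forall k : nat, 0 < (Phi p)`_k <-> 0 < p`_k.

Definition multiplicative_on_PQ (R : realType) (Phi : {poly R} -> {poly R}) :
    Prop :=
  forall p q : {poly R}, in_PQ p -> in_PQ q -> Phi (p * q) = Phi p * Phi q.

(* Main.v *)
(** Divide [Phi q] by its constant coefficient to get a multiplicative map [Psi]
    on rational polynomials with nonnegative coefficients and constant
    coefficient 1. If [Psi q] agrees with [q (gamma x)] in degrees below [k] for
    every [q], then the defect [(Psi q)_k - gamma^k q_k] turns products into
    sums, and it vanishes as soon as [q_k = 0].

    The defect of [f] depends only on [c = f_k]: if [f_k = g_k = c], take
    [e = 1 - c x^k + M (x^(k+1) + ... + x^(k+n))] with [M] and [n] large; then
    [f e] and [g e] have nonnegative coefficients, the [k]-th one being 0, and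
    [f * (g e) = g * (f e)] equates the two defects. For [k > 1], compare [f]
    with [(1 + x) (1 + c x^(k-1))], whose factors have no term of degree [k].
    For [k = 1], the products [(1 + s x) (1 + t x)] show that the defect is an
    additive function of [c], hence linear over the rationals, and it vanishes
    at [1 + x] by the choice of [gamma]. *)

Require Import Defs.
From mathcomp Require Import all_boot all_order all_algebra.
From mathcomp Require Import reals.
From mathcomp Require Import ring.
Set Implicit Arguments.
Unset Strict Implicit.
Unset Printing Implicit Defensive.
Import Order.TTheory GRing.Theory Num.Theory.
Local Open Scope ring_scope.

(** * Polynomials with nonnegative coefficients *)

Definition nneg_poly (F : numDomainType) (p : {poly F}) : Prop :=
  forall k : nat, 0 <= p`_k.

Definition unit_nneg_poly (F : numDomainType) (p : {poly F}) : Prop :=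
  nneg_poly p /\ p`_0 = 1.

Lemma nneg_polyM (F : numDomainType) (p q : {poly F}) :
  nneg_poly p -> nneg_poly q -> nneg_poly (p * q).
Proof. by move=> hp hq k; rewrite coefM sumr_ge0 // => i _; rewrite mulr_ge0. Qed.

Lemma unit_nneg_polyM (F : numDomainType) (p q : {poly F}) :
  unit_nneg_poly p -> unit_nneg_poly q -> unit_nneg_poly (p * q).
Proof.
move=> [hp p0] [hq q0]; split; first exact: nneg_polyM.
by rewrite coef0M p0 q0 mulr1.
Qed.

Lemma coef_le_horner1 (F : numDomainType) (p : {poly F}) (k : nat) :
  nneg_poly p -> p`_k <= p.[1].
Proof.
move=> hp; rewrite horner_coef.
have [lekp | ltkp] := leqP (size p) k.
  by rewrite nth_default // sumr_ge0 // => i _; rewrite expr1n mulr1.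
rewrite (bigD1 (Ordinal ltkp)) //= expr1n mulr1 lerDl sumr_ge0 // => i _.
by rewrite expr1n mulr1.
Qed.

Lemma unit_nneg_horner1_gt0 (F : numDomainType) (p : {poly F}) :
  unit_nneg_poly p -> 0 < p.[1].
Proof.
move=> [hp p0]; apply: (lt_le_trans ltr01).
by rewrite -{1}p0; apply: coef_le_horner1.
Qed.

Lemma coef_1DaXn (F : nzRingType) (a : F) (k i : nat) :
  (1 + a *: 'X^k)`_i = (if i == 0%N then 1 else 0) + (if i == k then a else 0).
Proof.
rewrite coefD coef1 coefZ coefXn.
by case: (i == 0%N); case: (i == k); rewrite ?mulr1n ?mulr0n ?mulr1 ?mulr0.
Qed.

Lemma unit_nneg_1DaXn (F : numDomainType) (a : F) (k : nat) :
  0 <= a -> (0 < k)%N -> unit_nneg_poly (1 + a *: 'X^k).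
Proof.
move=> ha hk; split; last by rewrite coef_1DaXn (ltn_eqF hk) addr0.
by move=> i; rewrite coef_1DaXn addr_ge0 //; case: ifP.
Qed.

(** With the two extreme terms split off, the remaining sum involves only coefficients of degrees 1
    to [k], which an induction on the degree controls. *)
Lemma coefM_ends (F : nzSemiRingType) (p q : {poly F}) (k : nat) :
  p`_0 = 1 -> q`_0 = 1 ->
  (p * q)`_k.+1 = p`_k.+1 + q`_k.+1 + \sum_(i < k) p`_i.+1 * q`_(k - i).
Proof.
move=> p0 q0; rewrite coefM big_ord_recl big_ord_recr /=.
rewrite /bump !add1n subSS subnn subn0 p0 q0 mul1r mulr1.
by rewrite addrCA addrC [_ + q`__]addrC addrAC.
Qed.

(** * A multiplier that cancels one coefficient *)

Section Multiplier.

Variables (F : numDomainType) (k : nat) (c M : F) (n : nat).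

Definition multiplier : {poly F} :=
  1 - c *: 'X^k + M *: ((\poly_(i < n) 1) * 'X^(k.+1)).

(** Below degree [k] the product agrees with [f], and in degree [k] the two contributions [c] and
    [- c] cancel. In degrees [k + 1] to [k + n] the constant coefficient of [f] meets the block of
    coefficients [M = c * A], which outweighs the negative term. Beyond them the negative term is 0,
    because [n] is at least the size of [f]. *)
Lemma unit_nneg_mul_multiplier (f : {poly F}) (A : F) :
  (0 < k)%N -> unit_nneg_poly f -> f`_k = c -> (forall i, f`_i <= A) ->
  M = c * A -> (size f <= n)%N ->
  unit_nneg_poly (f * multiplier) /\ (f * multiplier)`_k = 0.
Proof.
move=> k0 [hf f0] fk hA hM sf.
have c0 : 0 <= c by rewrite -fk.
have A0 : 0 <= A by rewrite (le_trans (hf 0%N)).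
have M0 : 0 <= M by rewrite hM mulr_ge0.
pose B : {poly F} := \poly_(i < n) 1.
have B0 : nneg_poly B by move=> i; rewrite coef_poly; case: ifP.
have coefE j : (f * multiplier)`_j = f`_j
    - c * (if (j < k)%N then 0 else f`_(j - k))
    + M * (if (j < k.+1)%N then 0 else (f * B)`_(j - k.+1)).
  rewrite /multiplier -/B mulrDr mulrBr mulr1 -!scalerAr mulrA.
  by rewrite coefD coefB !coefZ !coefMXn.
have coef_k : (f * multiplier)`_k = 0.
  by rewrite coefE ltnn ltnSn subnn f0 fk mulr1 mulr0 addr0 subrr.
split=> //; split; last by rewrite coefE k0 ltn0Sn !mulr0 subr0 addr0.
move=> j; have [jltk|ltkj|->] := ltngtP j k; last by rewrite coef_k.
  by rewrite coefE jltk (ltn_trans jltk) // !mulr0 subr0 addr0.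
rewrite coefE ltnNge ltnW //= ltnNge ltkj /=.
have [lt_n|ge_n] := ltnP (j - k.+1) n.
  have fB1 : 1 <= (f * B)`_(j - k.+1).
    rewrite coefM big_ord_recl /= f0 mul1r subn0 coef_poly lt_n lerDl.
    by apply: sumr_ge0 => i _; rewrite mulr_ge0.
  rewrite -addrA addr_ge0 // addrC subr_ge0.
  rewrite (@le_trans _ _ M) // ?hM ?ler_wpM2l //.
  by rewrite ler_peMr // -hM.
rewrite [f`_(j - k)]nth_default ?mulr0 ?subr0.
  by rewrite addr_ge0 // mulr_ge0 //; apply: nneg_polyM.
by rewrite (leq_trans sf) // (leq_trans ge_n) // leq_sub2l.
Qed.

End Multiplier.

(** One multiplier serves both polynomials: they share [c], the sum of their values at 1 bounds all
    their coefficients, and the sum of their sizes is a common [n]. *)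
Lemma common_multiplier (F : numDomainType) (f g : {poly F}) (k : nat) :
  (0 < k)%N -> unit_nneg_poly f -> unit_nneg_poly g -> f`_k = g`_k ->
  exists e : {poly F},
    [/\ unit_nneg_poly (f * e), unit_nneg_poly (g * e),
        (f * e)`_k = 0 & (g * e)`_k = 0].
Proof.
move=> k0 hf hg fg; pose A := f.[1] + g.[1].
have f1 := ltW (unit_nneg_horner1_gt0 hf).
have g1 := ltW (unit_nneg_horner1_gt0 hg).
have hfA i : f`_i <= A.
  by rewrite (le_trans (coef_le_horner1 i hf.1)) // lerDl.
have hgA i : g`_i <= A.
  by rewrite (le_trans (coef_le_horner1 i hg.1)) // lerDr.
exists (multiplier k g`_k (g`_k * A) (size f + size g)).
have [? ?] := unit_nneg_mul_multiplier k0 hf fg hfA erefl (leq_addr (size g) _).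
have [? ?] := unit_nneg_mul_multiplier k0 hg erefl hgA erefl (leq_addl (size f) _).
by [].
Qed.

(** Clearing the denominator: [denq t] copies of [t] add up to [numq t] copies of 1. *)
Lemma additive_nneg_rat_eq0 (F : numDomainType) (u : rat -> F) :
  (forall s t : rat, 0 <= s -> 0 <= t -> u (s + t) = u s + u t) ->
  u 1 = 0 -> forall t : rat, 0 <= t -> u t = 0.
Proof.
move=> uD u1.
have u0 : u 0 = 0 by apply: (addrI (u 0)); rewrite -uD // !addr0.
have uMn (t : rat) n : 0 <= t -> u (t *+ n) = u t *+ n.
  move=> t0; elim: n => [|n IHn]; first by rewrite !mulr0n.
  by rewrite !mulrS uD ?IHn // mulrn_wge0.
move=> t t0; have d0 : (0 < `|denq t|)%N by rewrite absz_gt0 denq_neq0.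
have tE : t *+ `|denq t|%N = 1 *+ `|numq t|%N.
  rewrite -[LHS]mulr_natr !natr_absz gtr0_norm ?denq_gt0 //.
  by rewrite ger0_norm ?numq_ge0 // numqE.
have := congr1 u tE; rewrite !uMn // u1 mul0rn => /eqP.
by rewrite mulrn_eq0 eqn0Ngt d0 /= => /eqP.
Qed.

(** * Multiplicative maps with constant coefficient 1 *)

Section UnitConstantCoefficient.

Variables (F : numFieldType) (Psi : {poly rat} -> {poly F}).
Hypothesis Psi0 : forall q : {poly rat}, unit_nneg_poly q -> (Psi q)`_0 = 1.
Hypothesis Psi_supp :
  forall (q : {poly rat}) k, unit_nneg_poly q -> q`_k = 0 -> (Psi q)`_k = 0.
Hypothesis PsiM : forall p q : {poly rat},
  unit_nneg_poly p -> unit_nneg_poly q -> Psi (p * q) = Psi p * Psi q.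

Let gamma := (Psi (1 + 1 *: 'X^1))`_1.
Let defect k q := (Psi q)`_k - gamma ^+ k * ratr q`_k.

Let defect_eq0 k q : unit_nneg_poly q -> q`_k = 0 -> defect k q = 0.
Proof. by move=> hq qk; rewrite /defect Psi_supp // qk rmorph0 mulr0 subrr. Qed.

(** The mixed terms of the product have degrees strictly between 0 and [k], where the defects
    vanish, so their powers of [gamma] multiply to [gamma ^+ k]. Only the two extreme terms
    remain. *)
Let defectM k p q :
  (forall i, (i < k)%N -> forall r, unit_nneg_poly r -> defect i r = 0) ->
  (0 < k)%N -> unit_nneg_poly p -> unit_nneg_poly q ->
  defect k (p * q) = defect k p + defect k q.
Proof.
case: k => // k IHk _ hp hq; rewrite /defect PsiM //.
rewrite !coefM_ends ?Psi0 ?hp.2 ?hq.2 // !rmorphD rmorph_sum /=.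
rewrite !mulrDr mulr_sumr.
suff -> : \sum_(i < k) (Psi p)`_i.+1 * (Psi q)`_(k - i) =
          \sum_(i < k) gamma ^+ k.+1 * ratr (p`_i.+1 * q`_(k - i)).
  by ring.
apply: eq_bigr => i _; have ik := ltn_ord i.
have /eqP := IHk i.+1 ik p hp; rewrite subr_eq0 => /eqP ->.
have ki : (k - i < k.+1)%N by rewrite ltnS leq_subr.
have /eqP := IHk (k - i)%N ki q hq; rewrite subr_eq0 => /eqP ->.
rewrite rmorphM mulrACA -exprD; congr (_ ^+ _ * _).
by rewrite addSn subnKC // ltnW.
Qed.

Let defect_eq k f g :
  (forall i, (i < k)%N -> forall r, unit_nneg_poly r -> defect i r = 0) ->
  (0 < k)%N -> unit_nneg_poly f -> unit_nneg_poly g -> f`_k = g`_k ->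
  defect k f = defect k g.
Proof.
move=> IHk k0 hf hg fg.
have [e [hfe hge fe0 ge0]] := common_multiplier k0 hf hg fg.
(* [e] may have a negative coefficient, so multiplicativity is applied only to the pairs [f],
   [g * e] and [g], [f * e]. *)
have := congr1 (defect k) (mulrCA f g e).
rewrite (defectM _ _ hf hge) // (defectM _ _ hg hfe) //.
by rewrite (defect_eq0 hge ge0) (defect_eq0 hfe fe0) !addr0.
Qed.

Let defect0 q : unit_nneg_poly q -> defect 0 q = 0.
Proof.
by move=> hq; rewrite /defect Psi0 // hq.2 rmorph1 expr0 mulr1 subrr.
Qed.

Let defect1 q : unit_nneg_poly q -> defect 1 q = 0.
Proof.
have IH1 i : (i < 1)%N -> forall r, unit_nneg_poly r -> defect i r = 0.
  by case: i => // _; apply: defect0.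
have hl (t : rat) : 0 <= t -> unit_nneg_poly (1 + t *: 'X^1).
  by move=> t0; apply: unit_nneg_1DaXn.
have coef1l (t : rat) : (1 + t *: 'X^1)`_1 = t.
  by rewrite coef_1DaXn add0r.
move=> hq; have q10 : 0 <= q`_1 by case: hq.
rewrite (@defect_eq 1 q (1 + q`_1 *: 'X^1)) ?coef1l //; last exact: hl.
apply: (@additive_nneg_rat_eq0 _ (fun t => defect 1 (1 + t *: 'X^1))) => //.
  move=> s t s0 t0; rewrite -defectM //; try exact: hl.
  (* [(1 + s x) (1 + t x)] and [1 + (s + t) x] share their coefficient of degree 1. *)
  apply: defect_eq => //; first by apply: hl; rewrite addr_ge0.
    by apply: unit_nneg_polyM; apply: hl.
  rewrite coefM_ends ?big_ord0 ?addr0 ?coef1l //.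
    exact: (hl _ s0).2.
  exact: (hl _ t0).2.
by rewrite /defect coef1l rmorph1 mulr1 expr1 subrr.
Qed.

Lemma coef_Psi q k :
  unit_nneg_poly q -> (Psi q)`_k = gamma ^+ k * ratr q`_k.
Proof.
move=> hq; apply/eqP; rewrite -subr_eq0; apply/eqP; rewrite -/(defect k q).
elim/ltn_ind: k q hq => -[|[|k]] IHk q hq; [exact: defect0|exact: defect1|].
have c0 : 0 <= q`_k.+2 by case: hq.
have h1 : unit_nneg_poly (1 + 1 *: 'X^1 : {poly rat}).
  exact: unit_nneg_1DaXn.
have h2 : unit_nneg_poly (1 + q`_k.+2 *: 'X^(k.+1)).
  exact: unit_nneg_1DaXn.
(* Degree 1 had to be treated apart: there the second factor would be [1 + c x^0], whose constant
   coefficient is not 1 in general. *)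
rewrite (@defect_eq k.+2 q ((1 + 1 *: 'X^1) * (1 + q`_k.+2 *: 'X^(k.+1)))) //.
- rewrite defectM // !defect_eq0 ?addr0 //.
    by rewrite coef_1DaXn /= eqn_leq ltnn addr0.
  by rewrite coef_1DaXn addr0.
- exact: unit_nneg_polyM.
rewrite scale1r expr1 mulrDl mul1r coefD coefXM /= !coef_1DaXn /=.
by rewrite eqxx eqn_leq ltnn /= !add0r.
Qed.

End UnitConstantCoefficient.

(** * From [Phi] to a map on rational polynomials and back *)

Lemma in_PQ_rat (R : realType) (p : {poly R}) :
  in_PQ p -> exists q : {poly rat}, p = map_poly ratr q.
Proof.
move=> [_ hp].
have [u hu] : exists u : 'I_(size p) -> rat, forall i : 'I_(size p), p`_i = ratr (u i).
  by apply: (@fin_all_exists _ (fun=> rat)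
    (fun (i : 'I_(size p)) a => p`_i = ratr a)) => i.
(* The [else] branch is never reached, since the index stays below [size p]. *)
exists (\poly_(i < size p) if insub i is Some j then u j else 0).
apply/polyP => i; rewrite coef_map coef_poly.
have [lti|lei] := ltnP i (size p); last by rewrite raddf0 nth_default.
by rewrite insubT; apply: (hu (Ordinal lti)).
Qed.

Lemma in_PQ_X (R : realType) : in_PQ ('X : {poly R}).
Proof.
split; first by split=> [k|]; rewrite ?coefX ?ler0n ?hornerX.
by move=> k; exists (k == 1)%:R; rewrite coefX ratr_nat.
Qed.

Section Boltzmann.

Variables (R : realType) (Phi : {poly R} -> {poly R}).
Hypothesis Phi_maps : maps_PQ_to_P Phi.
Hypothesis Phi_supp : support_preserving Phi.
Hypothesis Phi_mul : multiplicative_on_PQ Phi.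

(** Passes from constant coefficient 1 to value 1 at 1, where [Phi] is controlled; evaluation at 1
    is multiplicative, hence so is this rescaling. *)
Let normalize (q : {poly rat}) : {poly R} :=
  map_poly ratr ((q.[1])^-1 *: q).

Let normalizeM p q : normalize (p * q) = normalize p * normalize q.
Proof.
by rewrite /normalize -rmorphM /= hornerM invfM -scalerAl -scalerAr scalerA.
Qed.

Let normalize_PQ q : unit_nneg_poly q -> in_PQ (normalize q).
Proof.
move=> hq; have q1 := unit_nneg_horner1_gt0 hq.
split; last by move=> k; exists ((q.[1])^-1 *: q)`_k; rewrite coef_map.
split=> [k|].
  rewrite coef_map ler0q coefZ mulr_ge0 ?invr_ge0 ?(ltW q1) //.
  by case: hq.
rewrite -[X in _.[X]](rmorph1 (@ratr R)) horner_map hornerZ mulVf ?rmorph1 //.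
by rewrite gt_eqF.
Qed.

Let coef_normalize_gt0 q k :
  unit_nneg_poly q -> (0 < (normalize q)`_k) = (0 < q`_k).
Proof.
move=> hq; rewrite coef_map ltr0q coefZ pmulr_rgt0 //.
by rewrite invr_gt0 unit_nneg_horner1_gt0.
Qed.

Let Psi q := ((Phi (normalize q))`_0)^-1 *: Phi (normalize q).

Let Phi_normalize0_gt0 q : unit_nneg_poly q -> 0 < (Phi (normalize q))`_0.
Proof.
move=> hq; apply/(Phi_supp (normalize_PQ hq)).
by rewrite coef_normalize_gt0 // hq.2.
Qed.

Let Psi0 q : unit_nneg_poly q -> (Psi q)`_0 = 1.
Proof. by move=> hq; rewrite coefZ mulVf // gt_eqF // Phi_normalize0_gt0. Qed.

Let Psi_gt0 q k : unit_nneg_poly q -> 0 < (Psi q)`_k <-> 0 < q`_k.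
Proof.
move=> hq; rewrite coefZ pmulr_rgt0 ?invr_gt0 ?Phi_normalize0_gt0 //.
by rewrite -coef_normalize_gt0 //; apply: Phi_supp; apply: normalize_PQ.
Qed.

(** Support preservation only excludes a positive coefficient; a negative one is excluded because
    [Phi] takes values in P. *)
Let Psi_supp q k : unit_nneg_poly q -> q`_k = 0 -> (Psi q)`_k = 0.
Proof.
move=> hq qk; apply/eqP; rewrite eq_le; apply/andP; split.
  by rewrite leNgt; apply/negP => /(Psi_gt0 k hq); rewrite qk ltxx.
rewrite coefZ mulr_ge0 ?invr_ge0 ?(ltW (Phi_normalize0_gt0 hq)) //.
exact: (Phi_maps (normalize_PQ hq)).1.
Qed.

Let PsiM p q : unit_nneg_poly p -> unit_nneg_poly q ->
  Psi (p * q) = Psi p * Psi q.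
Proof.
move=> hp hq; rewrite /Psi normalizeM Phi_mul; try exact: normalize_PQ.
by rewrite coef0M invfM -scalerAl -scalerAr scalerA.
Qed.

Let gamma := (Psi (1 + 1 *: 'X^1))`_1.

Let gamma_gt0 : 0 < gamma.
Proof.
apply/Psi_gt0; first exact: unit_nneg_1DaXn.
by rewrite coef_1DaXn add0r.
Qed.

(** Only the coefficient of degree 1 can survive, and the value 1 at 1 fixes it. This lets powers of
    x be split off from polynomials without constant term. *)
Lemma Phi_X : Phi 'X = 'X.
Proof.
have [hX PX1] := Phi_maps (in_PQ_X R).
have coefE k : (k != 1)%N -> (Phi 'X)`_k = 0.
  move=> k1; apply/eqP; rewrite eq_le hX andbT leNgt; apply/negP.
  by move/(Phi_supp (in_PQ_X R)); rewrite coefX (negbTE k1) ltxx.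
have PXE : Phi 'X = (Phi 'X)`_1 *: 'X.
  apply/polyP => k; rewrite coefZ coefX.
  by have [->|/coefE ->] := eqVneq k 1%N; rewrite ?mulr1n ?mulr1 ?mulr0n ?mulr0.
by move: PX1; rewrite PXE hornerZ hornerX mulr1 => ->; rewrite scale1r.
Qed.

Lemma Phi_coef0_neq0 (p : {poly R}) : in_PQ p -> p`_0 != 0 ->
  exists a, forall k, (Phi p)`_k = a * (gamma ^+ k * p`_k).
Proof.
move=> hp p0; have [q pq] := in_PQ_rat hp.
have q0 : q`_0 != 0.
  by apply: contra_neq p0 => q0; rewrite pq coef_map q0 raddf0.
have q0_gt0 : 0 < q`_0.
  by rewrite lt_neqAle eq_sym q0 -(ler0q R) -coef_map -pq hp.1.1.
(* Since [q.[1] = 1], normalizing [r] gives back [p]. *)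
pose r := (q`_0)^-1 *: q.
have hr : unit_nneg_poly r.
  split; last by rewrite coefZ mulVf.
  move=> k; rewrite coefZ mulr_ge0 ?invr_ge0 ?(ltW q0_gt0) //.
  by rewrite -(ler0q R) -coef_map -pq hp.1.1.
have q1 : q.[1] = 1.
  apply: (fmorph_inj (@ratr R)); rewrite rmorph1 -horner_map rmorph1 -pq.
  exact: hp.1.2.
have rp : normalize r = p.
  rewrite /normalize pq hornerZ q1 mulr1 invrK /r scalerA mulfV //.
  by rewrite scale1r.
have P0 := Phi_normalize0_gt0 hr.
exists ((Phi p)`_0 / ratr q`_0) => k.
have := coef_Psi Psi0 Psi_supp PsiM k hr.
rewrite -/gamma coefZ rp => /(congr1 (fun x => (Phi p)`_0 * x)).
rewrite rp in P0; rewrite mulVKf ?gt_eqF // => ->.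
by rewrite coefZ pq coef_map rmorphM fmorphV /=; ring.
Qed.

Lemma Phi_coef (p : {poly R}) : in_PQ p ->
  exists a, forall k, (Phi p)`_k = a * (gamma ^+ k * p`_k).
Proof.
elim/poly_ind: p => [|p c IHp] hp.
  by case: hp => -[_ /eqP]; rewrite horner0 eq_sym oner_eq0.
have [c0|c0] := eqVneq c 0; last first.
  by apply: Phi_coef0_neq0; rewrite // coefD coefMX coefC add0r.
move: hp; rewrite {}c0 addr0 => hp.
have pE k : p`_k = (p * 'X)`_k.+1 by rewrite coefMX.
have hp' : in_PQ p.
  case: hp => -[nn p1] hrat; split; last by move=> k; rewrite pE.
  by split=> [k|]; [rewrite pE | move: p1; rewrite hornerM hornerX mulr1].
have [a ha] := IHp hp'.
(* Multiplication by x raises the degree by one, and the extra factor [gamma] is absorbed into the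
   constant. *)
exists (a / gamma) => -[|k]; rewrite Phi_mul ?Phi_X //; try exact: in_PQ_X.
  by rewrite !coefMX !mulr0.
by rewrite !coefMX /= ha exprS -!mulrA mulKf // gt_eqF.
Qed.

Lemma Phi_tilt : exists gamma : R, 0 < gamma /\
  forall p : {poly R}, in_PQ p ->
    forall x : R, (Phi p).[x] = p.[gamma * x] / p.[gamma].
Proof.
exists gamma; split=> // p hp; have [a ha] := Phi_coef hp.
have PhiE x : (Phi p).[x] = a * p.[gamma * x].
  have -> : Phi p = a *: \poly_(i < size p) (gamma ^+ i * p`_i).
    apply/polyP => k; rewrite ha coefZ coef_poly.
    by case: ltnP => // lek; rewrite [p`_k]nth_default // mulr0.
  rewrite hornerZ horner_poly horner_coef; congr (_ * _).
  by apply: eq_bigr => i _; rewrite exprMn; ring.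
(* Evaluation at 1, where [Phi p] has value 1, identifies [a] as the inverse of [p.[gamma]]. *)
have := PhiE 1; rewrite (Phi_maps hp).2 mulr1 => ap x.
have pg : p.[gamma] != 0.
  by apply: contra_eq_neq ap => ->; rewrite mulr0 oner_eq0.
by rewrite PhiE; apply: (mulIf pg); rewrite divfK // mulrAC -ap mul1r.
Qed.

End Boltzmann.

Theorem theorem3 (R : realType) (Phi : {poly R} -> {poly R})
    (Phi_maps : maps_PQ_to_P Phi)
    (Phi_supp : support_preserving Phi)
    (Phi_mul : multiplicative_on_PQ Phi) :
  exists gamma : R, 0 < gamma /\
    forall p : {poly R}, in_PQ p ->
      forall x : R, (Phi p).[x] = p.[gamma * x] / p.[gamma].
Proof. exact: Phi_tilt. Qed.
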